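(* Let $K$ be a field and let $\mathbb{X}=\{p_1,\dots,p_s\}\subseteq\mathbb{P}^2_K$ be a set of $s$ distinct $K$-rational points, none on the line $X_0=0$. If $\mathbb{X}$ has minimal Dedekind different, then $\delta_{\mathbb{X}}=\vartheta_{\mathbb{X}}$, where $\delta_{\mathbb{X}}$ is the Dedekind different and $\vartheta_{\mathbb{X}}$ is the Kähler different of $\mathbb{X}$.
   Context: For a set $\mathbb{X}$ of $s$ distinct $K$-rational points of $\mathbb{P}^n_K$ (here $n=2$): $P=K[X_0,\dots,X_n]$ has the standard grading, $I_{\mathbb{X}}\subseteq P$ is the homogeneous vanishing ideal of $\mathbb{X}$ (with reduced structure), $R=P/I_{\mathbb{X}}$, and $x_0$ is the residue class of $X_0$, a non-zerodivisor of $R$. $\mathrm{HF}_{\mathbb{X}}(i)=\dim_KR_i$, and $r_{\mathbb{X}}$ is the least integer such that $\mathrm{HF}_{\mathbb{X}}(i)=s$ for all $i\ge r_{\mathbb{X}}$. Kähler different. If $F_1,\dots,F_r$ is a homogeneous system of generators of $I_{\mathbb{X}}$, then $\vartheta_{\mathbb{X}}$ is the homogeneous ideal of $R$ generated by (the residue classes of) all $n$-minors of the Jacobian matrix $(\partial F_j/\partial X_i)_{i=1,\dots,n;\,j=1,\dots,r}$ (derivatives with respect to $X_1,\dots,X_n$ only). Dedekind different. $Q^h(R)=R_{x_0}\cong\prod_{j=1}^sK[T_j,T_j^{-1}]$, $\deg T_j=1$, with $f\in R_i$ mapping to $(f(p_1)T_1^i,\dots,f(p_s)T_s^i)$, where points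 are written $p_j=(1:p_{j1}:\dots:p_{jn})$ and $f(p_j)$ is the value of a representative at $(1,p_{j1},\dots,p_{jn})$. $L_0=K[x_0,x_0^{-1}]$, and $\sigma:Q^h(R)\to L_0$, $\sigma(h_1(T_1),\dots,h_s(T_s))=\sum_jh_j(x_0)$, is the canonical trace map, for which $\underline{\mathrm{Hom}}_{L_0}(Q^h(R),L_0)=Q^h(R)\cdot\sigma$. The Dedekind complementary module $\mathfrak{C}_{\mathbb{X}}\subseteq Q^h(R)$ is the image of the injection $\underline{\mathrm{Hom}}_{K[x_0]}(R,K[x_0])\to\underline{\mathrm{Hom}}_{L_0}(Q^h(R),L_0)=Q^h(R)\sigma\cong Q^h(R)$, $\varphi\mapsto\varphi\otimes\mathrm{id}_{L_0}$ (the last isomorphism sending $g\sigma$ to $g$). The Dedekind different is $\delta_{\mathbb{X}}=\{f\in Q^h(R)\mid f\cdot\mathfrak{C}_{\mathbb{X}}\subseteq R\}$, a homogeneous ideal of $R$. $\mathbb{X}$ has minimal Dedekind different if $\delta_{\mathbb{X}}=\bigoplus_{i\ge2r_{\mathbb{X}}}R_i$. *)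

(* Defs.v *)
From HB Require Import structures.
From mathcomp Require Import all_boot all_order all_algebra.
From mathcomp.multinomials Require Import mpoly.

Set Implicit Arguments.
Unset Strict Implicit.
Unset Printing Implicit Defensive.

Import GRing.Theory.
Local Open Scope ring_scope.
Local Open Scope quotient_scope.

Definition ideal_gen (A : comPzRingType) (S : A -> Prop) (f : A) : Prop :=
  exists (N : nat) (a g : 'I_N -> A),
    (forall k, S (g k)) /\ f = \sum_(k < N) a k * g k.

(* A finite nonempty family of points of P^n off the hyperplane X_0 = 0, given
   by homogeneous coordinates.  A point is the line spanned by its coordinate
   vector, and (u == v)%MS says that the two lines coincide. *)
Definition affine_points (K : fieldType) (n s : nat)
    (x : 'I_s.+1 -> 'rV[K]_n.+1) : Prop :=
  (forall j, x j 0 0 != 0) /\ (forall i j, (x i == x j)%MS -> i = j).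

Section PointSet.
Variables (K : fieldType) (n s : nat) (x : 'I_s.+1 -> 'rV[K]_n.+1).

Local Notation P := {mpoly K[n.+1]}.

(* The representative (1 : p_j1 : ... : p_jn). *)
Definition normalized (j : 'I_s.+1) : 'rV[K]_n.+1 := (x j 0 0)^-1 *: x j.

(* F lies in the homogeneous vanishing ideal iff each homogeneous component of
   F vanishes at every point; over a finite field this is stronger than the
   vanishing of F at all coordinate vectors. *)
Definition vanishing_ideal (F : P) : bool :=
  [forall j : 'I_s.+1, forall d : 'I_(msize F),
    (pihomog mdeg d F).@[fun i => x j 0 i] == 0].

(* The restriction of F to the line spanned by v, as a polynomial in T. *)
Definition line_restr (v : 'rV[K]_n.+1) (F : P) : {poly K} :=
  mmap (@polyC K) (fun i => v 0 i *: 'X) F.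

Lemma coef_line_restr v F d :
  (line_restr v F)`_d = (pihomog mdeg d F).@[fun i => v 0 i].
Proof.
rewrite /line_restr /mmap coef_sum pihomogE raddf_sum /= [RHS]big_mkcond /=.
apply: eq_bigr => m _; rewrite /mmap1 mevalZ mevalX.
rewrite (eq_bigr (fun i => (v 0 i ^+ m i) *: 'X^(m i))); last first.
  by move=> i _; rewrite exprZn.
rewrite scaler_prod -expr_sum coefCM coefZ coefXn mdegE eq_sym.
by case: eqP => _; rewrite ?mulr1 ?mulr0.
Qed.

Lemma vanishing_idealP F :
  reflect (forall j, line_restr (x j) F = 0) (vanishing_ideal F).
Proof.
apply: (iffP idP) => [h j | h].
  apply/polyP => d; rewrite coef0 coef_line_restr.
  case: (ltnP d (msize F)) => [ltd | led].
    by move/forallP: h => /(_ j) /forallP /(_ (Ordinal ltd)) /eqP.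
  rewrite pihomogE big_seq_cond big1 ?meval0 // => m /andP[mF /eqP dm].
  by have := msize_mdeg_lt mF; rewrite dm ltnNge led.
by apply/forallP => j; apply/forallP => d; rewrite -coef_line_restr h coef0.
Qed.

Lemma line_restrM v : {morph line_restr v : F G / F * G}.
Proof.
exact: rmorphM.
Qed.

Lemma vanishing_ideal_idealr : idealr_closed vanishing_ideal.
Proof.
split.
- by apply/vanishing_idealP => j; rewrite /line_restr raddf0.
- apply/negP => /vanishing_idealP /(_ ord0) /eqP.
  by rewrite /line_restr rmorph1 oner_eq0.
- move=> a F G /vanishing_idealP hF /vanishing_idealP hG.
  apply/vanishing_idealP => j.
  by rewrite /line_restr raddfD /= -!/(line_restr _ _) line_restrM hF hG mulr0 addr0.
Qed.

HB.instance Definition _ := isIdealr.Build P vanishing_ideal vanishing_ideal_idealr.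

Definition coord_ideal : idealr P := vanishing_ideal.

Definition coord_ring := {ideal_quot coord_ideal}.
HB.instance Definition _ := GRing.ComNzRing.on coord_ring.

Local Notation R := coord_ring.

Definition residue (F : P) : R := \pi_coord_ring F.

Definition homog_part (i : nat) (f : R) : Prop :=
  exists2 F : P, F \is i.-homog & f = residue F.

(* The direct sum of the R_i with i >= k. *)
Definition truncation (k : nat) (f : R) : Prop :=
  exists (N : nat) (d : 'I_N -> nat) (a : 'I_N -> R),
    (forall l, (k <= d l)%N /\ homog_part (d l) (a l)) /\
    f = \sum_(l < N) a l.

(* HF_X(i) = h : R_i has a K-basis with h elements. *)
Definition hilbert_function (i h : nat) : Prop :=
  exists e : 'I_h -> R,
    [/\ forall k, homog_part i (e k),
        forall c : 'I_h -> K,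
          \sum_(k < h) residue (c k)%:MP * e k = 0 -> forall k, c k = 0
      & forall f, homog_part i f ->
          exists c : 'I_h -> K, f = \sum_(k < h) residue (c k)%:MP * e k].

Definition regularity_index (r : nat) : Prop :=
  (forall i, (r <= i)%N -> hilbert_function i s.+1) /\
  (forall r', (forall i, (r' <= i)%N -> hilbert_function i s.+1) ->
     (r <= r')%N).

Definition homog_generators (m : nat) (F : 'I_m -> P) : Prop :=
  (forall j, exists d : nat, F j \is d.-homog) /\
  (forall G : P, vanishing_ideal G <->
     ideal_gen (fun H => exists j, H = F j) G).

(* The n-minor of the Jacobian matrix on the columns c 0, ..., c (n-1);
   lift ord0 a is the index of X_(a+1), so that X_0 is left out. *)
Definition jacobian_minor (m : nat) (F : 'I_m -> P) (c : 'I_n -> 'I_m) : P :=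
  \det (\matrix_(a < n, b < n) mderiv (lift ord0 a) (F (c b))).

Definition kaehler_different (m : nat) (F : 'I_m -> P) : R -> Prop :=
  ideal_gen (fun g => exists c : 'I_n -> 'I_m,
    (forall a b : 'I_n, (a < b)%N -> (c a < c b)%N) /\
    g = residue (jacobian_minor F c)).

(* Laurent polynomials over K are taken inside K(T), and all the variables T_j
   as well as x_0 are represented by T. *)
Local Notation L := {fraction {poly K}}.

Definition laurent (h : L) : Prop :=
  exists (k : nat) (q : {poly K}), h = tofrac q / tofrac 'X^k.

Local Notation Q := {ffun 'I_s.+1 -> L}.

(* Q^h(R) = K[T_1,1/T_1] x ... x K[T_s,1/T_s], inside a product of fields. *)
Definition Qh (g : Q) : Prop := forall j, laurent (g j).

(* The injection R -> Q^h(R), f in R_i |-> (f(p_j) T_j^i)_j. *)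
Definition embed (f : R) : Q :=
  [ffun j => tofrac (\sum_(i < msize (repr f))
     (pihomog mdeg i (repr f)).@[fun k => normalized j 0 k] *: 'X^i)].

(* The L_0-module structure: x_0 acts on Q^h(R) as embed x_0 = (T_1,...,T_s). *)
Definition L0_scale (l : L) (g : Q) : Q := [ffun j => l * g j].

(* The trace: substituting x_0 for T_j is the identity of K(T). *)
Definition sigma (g : Q) : L := \sum_(j < s.+1) g j.

(* The action of K[x_0], identified with {poly K}, on R. *)
Definition Kx0_scale (q : {poly K}) (f : R) : R :=
  residue (map_poly (@mpolyC n.+1 K) q).['X_ord0] * f.

Definition Kx0_linear (phi : R -> {poly K}) : Prop :=
  forall q f g, phi (Kx0_scale q f + g) = q * phi f + phi g.

Definition of_degree (d : int) (phi : R -> {poly K}) : Prop :=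
  forall i f, homog_part i f ->
    forall k : nat, (phi f)`_k != 0 -> k%:Z = i%:Z + d.

(* The graded Hom: finite sums of homogeneous K[x_0]-linear maps. *)
Definition graded_Hom (phi : R -> {poly K}) : Prop :=
  exists (N : nat) (d : 'I_N -> int) (psi : 'I_N -> R -> {poly K}),
    (forall l, Kx0_linear (psi l) /\ of_degree (d l) (psi l)) /\
    (forall f, phi f = \sum_(l < N) psi l f).

(* Phi = phi (x) id, where Q^h(R) is identified with the tensor product of R
   and L_0 over K[x_0]: the L_0-linear map Q^h(R) -> L_0 extending phi. *)
Definition tensor_id (phi : R -> {poly K}) (Phi : Q -> L) : Prop :=
  [/\ forall g, Qh g -> laurent (Phi g),
      forall l g h, laurent l -> Qh g -> Qh h ->
        Phi (L0_scale l g + h) = l * Phi g + Phi h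
    & forall f, Phi (embed f) = tofrac (phi f)].

Definition complementary_module (g : Q) : Prop :=
  Qh g /\ exists (phi : R -> {poly K}) (Phi : Q -> L),
    [/\ graded_Hom phi, tensor_id phi Phi
      & forall h, Qh h -> Phi h = sigma (g * h)].

Definition dedekind_different (f : Q) : Prop :=
  Qh f /\ forall g, complementary_module g -> exists a : R, f * g = embed a.

Definition minimal_dedekind_different : Prop :=
  exists r : nat, regularity_index r /\
    forall f : Q, dedekind_different f <->
      exists2 a : R, truncation (2 * r) a & f = embed a.

End PointSet.

(* Main.v *)
Require Import Defs.
From HB Require Import structures.
From mathcomp Require Import all_boot all_order all_algebra perm.
From mathcomp.multinomials Require Import mpoly.

Set Implicit Arguments.
Unset Strict Implicit.
Unset Printing Implicit Defensive.

Import GRing.Theory.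
Local Open Scope ring_scope.

(* The Kaehler different lies in the Dedekind different for every set of points
   off X_0 = 0.  If G_1, ..., G_n lie in the ideal, write
   G_b(X) - G_b(Y) = sum_a (X_a - Y_a) D_ab(X, Y) and
   det D_ab = sum_t A_t(X) B_t(Y).  By Cramer's rule det D_ab vanishes at
   (p_k, p_j) for k != j, and on the diagonal it is the Jacobian J of the G_b.
   Hence J g = sum_t A_t sigma(g B_t) lies in R for all g in the complementary
   module.

   Conversely, for n >= 2 the Kaehler different contains R_i for i >= n r: if f
   in R_r vanishes at every point except p_j, then the Jacobian determinant of
   the elements (X_b - p_jb X_0) f of the ideal has degree n r, is nonzero at
   p_j, and vanishes at the other points, where the matrix has rank <= 1.  With
   n = 2 a minimal Dedekind different is the direct sum of the R_i, i >= 2r. *)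

(** * Closure properties of generated ideals *)

Section IdealGen.
Variables (A : comPzRingType) (S : A -> Prop).

Lemma ideal_gen_incl f : S f -> ideal_gen S f.
Proof.
move=> Sf; exists 1, (fun=> 1), (fun=> f); split=> //.
by rewrite big_ord1 mul1r.
Qed.

Lemma ideal_gen0 : ideal_gen S 0.
Proof. by exists 0, (fun=> 0), (fun=> 0); split=> [[]//|]; rewrite big_ord0. Qed.

Lemma ideal_genD f g : ideal_gen S f -> ideal_gen S g -> ideal_gen S (f + g).
Proof.
move=> [N [a [h [Sh ->]]]] [N' [a' [h' [Sh' ->]]]].
exists (N + N'), (fun k => match split k with inl i => a i | inr i => a' i end),
  (fun k => match split k with inl i => h i | inr i => h' i end); split.
  by move=> k; case: split.
rewrite big_split_ord /=; congr (_ + _); apply: eq_bigr => i _.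
  by rewrite -[lshift _ _]/(unsplit (inl i)) unsplitK.
by rewrite -[rshift _ _]/(unsplit (inr i)) unsplitK.
Qed.

Lemma ideal_genM c f : ideal_gen S f -> ideal_gen S (c * f).
Proof.
move=> [N [a [h [Sh ->]]]]; exists N, (fun k => c * a k), h; split=> //.
by rewrite mulr_sumr; apply: eq_bigr => k _; rewrite mulrA.
Qed.

Lemma ideal_gen_sum (I : Type) (r : seq I) (p : pred I) (E : I -> A) :
  (forall i, p i -> ideal_gen S (E i)) -> ideal_gen S (\sum_(i <- r | p i) E i).
Proof.
move=> SE; apply: (big_ind (ideal_gen S)) => //; first exact: ideal_gen0.
exact: ideal_genD.
Qed.

End IdealGen.

(** * Determinant identities and the sorting of column choices *)

Section Determinants.
Variable A : comNzRingType.

(** Factor out [diag_mx] of [u]: what remains has all rows equal, and size at least 2 provides two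
    of them. *)
Lemma det_outer_product n (u v : 'I_n.+2 -> A) :
  \det (\matrix_(i, j) (u i * v j)) = 0.
Proof.
have -> : \matrix_(i, j) (u i * v j)
    = diag_mx (\row_i u i) *m (\matrix_(i < n.+2) \row_j v j).
  by apply/matrixP=> i j; rewrite mul_diag_mx !mxE.
rewrite det_mulmx (@determinant_alternate _ _ (\matrix_i _) ord0 (lift ord0 ord0)).
- by rewrite mulr0.
- by [].
by move=> j; rewrite !mxE.
Qed.

(** Multilinearity in the columns. Summands are left indexed by all choices [f], not collected into
    minors as in Cauchy-Binet, which suffices for ideal membership. *)
Lemma det_col_comb n m (B : 'I_n -> 'I_m -> A) (C : 'I_m -> 'I_n -> A) :
  \det (\matrix_(a, b) \sum_k B a k * C k b) =
  \sum_(f : {ffun 'I_n -> 'I_m})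
     (\prod_b C (f b) b) * \det (\matrix_(a, b) B a (f b)).
Proof.
rewrite -det_tr.
transitivity (\sum_(f : {ffun 'I_n -> 'I_m}) \sum_(s : 'S_n)
   (-1) ^+ s * \prod_b (B (s b) (f b) * C (f b) b)).
  rewrite exchange_big; apply: eq_bigr => s _ /=.
  rewrite -mulr_sumr -(bigA_distr_bigA (fun b k => B (s b) k * C k b)).
  by congr (_ * _); apply: eq_bigr => b _; rewrite !mxE.
apply: eq_bigr => f _; rewrite -det_tr mulr_sumr; apply: eq_bigr => s _.
rewrite big_split /= mulrCA mulrA mulrC; congr (_ * _); rewrite mulrC; congr (_ * _).
by apply: eq_bigr => b _; rewrite !mxE.
Qed.

End Determinants.

(** [c] enumerates the sorted image of [f], and [t b] is the position of [f b] in it. *)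
Lemma sort_injective_ord n m (f : 'I_n -> 'I_m) : injective f ->
  exists (c : 'I_n -> 'I_m) (t : 'S_n),
    (forall a b : 'I_n, (a < b)%N -> (c a < c b)%N) /\ (forall b, f b = c (t b)).
Proof.
case: n f => [|n] f f_inj; first by exists f, 1%g; split=> [[]|[]].
pose le := relpre (@nat_of_ord m) leq.
pose lt := relpre (@nat_of_ord m) ltn.
pose s := sort le (codom f).
have ps : perm_eq s (codom f) by rewrite perm_sort.
have ss : size s = n.+1 by rewrite (perm_size ps) size_codom card_ord.
have us : uniq s by rewrite (perm_uniq ps) map_inj_uniq ?enum_uniq.
have sorted_s : sorted lt s.
  have : sorted ltn (map (@nat_of_ord m) s).
    rewrite ltn_sorted_uniq_leq map_inj_uniq ?us ?sorted_map; last exact: ord_inj.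
    by apply: sort_sorted => i j; apply: leq_total.
  by rewrite sorted_map.
have idx b : (index (f b) s < n.+1)%N.
  by rewrite -ss index_mem (perm_mem ps) codom_f.
have t_inj : injective (fun b => Ordinal (idx b)).
  move=> a b [] /(congr1 (nth (f a) s)); rewrite !nth_index ?(perm_mem ps) ?codom_f //.
  exact: f_inj.
exists (fun i => nth (f ord0) s i), (perm t_inj); split=> [a b ab|b]; last first.
  by rewrite permE /= nth_index // (perm_mem ps) codom_f.
have := @sorted_ltn_nth _ lt _ (f ord0) _ sorted_s a b.
rewrite !inE ss => H; apply: H => //.
by move=> i j k; apply: ltn_trans.
Qed.

Lemma mderivU (n : nat) (A : comNzRingType) (i j : 'I_n) :
  mderiv i ('X_j : {mpoly A[n]}) = (j == i)%:R.
Proof.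
rewrite mderivX mnmE; case: eqVneq => [->|_]; last by rewrite scale0r.
rewrite scale1r (_ : (U_(i) - U_(i) = 0)%MM) ?mpolyX0 //.
by apply/mnmP => l; rewrite mnmBE mnm0E subnn.
Qed.

(** * Restriction of polynomials to lines through the origin *)

Section LineRestriction.
Variables (K : fieldType) (n : nat).
Local Notation P := {mpoly K[n.+1]}.
Implicit Types (v : 'rV[K]_n.+1) (F G : P).

Definition line_mmap v : {rmorphism P -> {poly K}} :=
  mmap (@polyC K) (fun i => v 0 i *: 'X).
HB.instance Definition _ v := GRing.RMorphism.copy (line_restr v) (line_mmap v).

Lemma line_restrC v c : line_restr v c%:MP = c%:P.
Proof. by rewrite /line_restr mmapC. Qed.

Lemma line_restrU v i : line_restr v 'X_i = v 0 i *: 'X.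
Proof. by rewrite /line_restr mmapX mmap1U. Qed.

Lemma line_restr_scale c v F :
  line_restr (c *: v) F = line_restr v F \Po (c *: 'X).
Proof.
rewrite /line_restr /mmap raddf_sum; apply: eq_bigr => mu _ /=.
rewrite rmorphM /= comp_polyC /mmap1 rmorph_prod; congr (_ * _).
apply: eq_bigr => i _ /=; rewrite rmorphXn /= comp_polyZ comp_polyX mxE scalerA.
by rewrite mulrC.
Qed.

Lemma line_restr_homog v d F : F \is d.-homog ->
  line_restr v F = F.@[fun i => v 0 i] *: 'X^d.
Proof.
move=> Fd; apply/polyP => e; rewrite coef_line_restr coefZ coefXn.
have [->|ne] := eqVneq e d; first by rewrite pihomog_dE ?mulr1.
by rewrite (pihomog_ne0 _ Fd) ?meval0 ?mulr0 // eq_sym.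
Qed.

End LineRestriction.

(** * The coordinate ring and its embedding into [Qh] *)

Section CoordinateRing.
Variables (K : fieldType) (n s : nat) (x : 'I_s.+1 -> 'rV[K]_n.+1).
Local Notation P := {mpoly K[n.+1]}.
Local Notation R := (coord_ring x).
Implicit Types (F G : P) (j k : 'I_s.+1).

HB.instance Definition _ := GRing.RMorphism.copy (residue x)
  (\pi_(coord_ring x)%qT : P -> R).

Lemma residueP F G : residue x F = residue x G <-> F - G \in vanishing_ideal x.
Proof.
rewrite (Quotient.idealrBE (coord_ideal x)).
by split=> [/eqP|/eqP].
Qed.

Definition point_restr j : P -> {poly K} := line_restr (normalized x j).
HB.instance Definition _ j := GRing.RMorphism.copy (point_restr j)
  (line_restr (normalized x j)).

Lemma point_restrU j i : point_restr j 'X_i = normalized x j 0 i *: 'X.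
Proof. exact: line_restrU. Qed.

Lemma point_restrC j c : point_restr j c%:MP = c%:P.
Proof. exact: line_restrC. Qed.

(** The truncation of the sum at [msize] loses nothing: homogeneous components of higher degree are
    zero. *)
Lemma embedE (f : R) :
  embed f = [ffun j => tofrac (point_restr j (repr f))].
Proof.
apply/ffunP => j; rewrite !ffunE; congr tofrac.
apply/polyP => d; rewrite coef_line_restr coef_sum.
under eq_bigr do rewrite coefZ coefXn.
have [ltd|led] := ltnP d (msize (repr f)).
  rewrite (bigD1 (Ordinal ltd)) //= eqxx mulr1 big1 ?addr0 // => i ne.
  by rewrite eq_sym (_ : (i == d :> nat) = false) ?mulr0 //; apply: negbTE.
rewrite big1 => [|i _]; last first.
  by rewrite gtn_eqF ?mulr0 // (leq_trans (ltn_ord i)).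
rewrite pihomogE big_seq_cond big1 ?meval0 // => mu /andP[muf /eqP dm].
by have := msize_mdeg_lt muf; rewrite dm ltnNge led.
Qed.

Hypothesis x_affine : affine_points x.

Lemma normalized0 j : normalized x j 0 0 = 1.
Proof. by rewrite mxE mulVf // (proj1 x_affine). Qed.

Lemma normalized_inj : injective (normalized x).
Proof.
move=> j k e; apply: (proj2 x_affine).
have nz i : (x i 0 0)^-1 != 0 by rewrite invr_eq0 (proj1 x_affine).
apply/eqmxP/(eqmx_trans (eqmx_sym (eqmx_scale _ (nz j)))).
by rewrite -/(normalized x j) e; apply: eqmx_scale.
Qed.

Lemma vanishing_point_restr F :
  F \in vanishing_ideal x <-> forall j, point_restr j F = 0.
Proof.
split=> [/vanishing_idealP xF0 j | nF0].
  by rewrite /point_restr line_restr_scale xF0 comp_poly0.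
apply/vanishing_idealP => j.
have -> : x j = x j 0 0 *: normalized x j.
  by rewrite scalerA mulfV ?scale1r ?(proj1 x_affine).
by rewrite line_restr_scale -/(point_restr j F) nF0 comp_poly0.
Qed.

Lemma residue_eq F G :
  (forall j, point_restr j F = point_restr j G) -> residue x F = residue x G.
Proof.
by move=> eFG; apply/residueP/vanishing_point_restr => j; rewrite rmorphB /= eFG subrr.
Qed.

(** Frees [embed] from the chosen representative: two representatives differ by an element of the
    ideal, which restricts to 0. *)
Lemma embed_residue F : embed (residue x F) = [ffun j => tofrac (point_restr j F)].
Proof.
rewrite embedE; apply/ffunP => j; rewrite !ffunE; congr tofrac.
apply/eqP; rewrite -subr_eq0 -rmorphB; apply/eqP.
have /residueP/vanishing_point_restr := reprK (residue x F).
exact.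
Qed.

End CoordinateRing.

(** * The Kaehler different lies in the Dedekind different *)

Section KaehlerInDedekind.
Variables (K : fieldType) (n s : nat) (x : 'I_s.+1 -> 'rV[K]_n.+1).
Local Notation P := {mpoly K[n.+1]}.
Local Notation R := (coord_ring x).
Implicit Types (F G : P) (M : 'I_s.+1 -> 'I_s.+1 -> {poly K}).

(* [M k j] is the value at (p_k, p_j) of an element of P (x)_{K[x_0]} P; as
   both X_0 (x) 1 and 1 (x) X_0 take the value T, the tensor product over K has
   the same values. *)
Definition separable M := exists r : seq (P * P),
  forall k j, M k j = \sum_(t <- r) point_restr x k t.1 * point_restr x j t.2.

Lemma eq_separable M N : (forall k j, M k j = N k j) -> separable M -> separable N.
Proof. by move=> e [r rM]; exists r => k j; rewrite -e. Qed.

Lemma separable_left F : separable (fun k _ => point_restr x k F).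
Proof. by exists [:: (F, 1)] => k j; rewrite big_seq1 /= rmorph1 mulr1. Qed.

Lemma separable_right F : separable (fun _ j => point_restr x j F).
Proof. by exists [:: (1, F)] => k j; rewrite big_seq1 /= rmorph1 mul1r. Qed.

Lemma separable_const c : separable (fun _ _ => c%:P).
Proof.
by apply: eq_separable (separable_left c%:MP) => k j; rewrite point_restrC.
Qed.

Lemma separableD M N :
  separable M -> separable N -> separable (fun k j => M k j + N k j).
Proof.
by move=> [r rM] [t tN]; exists (r ++ t) => k j; rewrite big_cat rM tN.
Qed.

Lemma separableM M N :
  separable M -> separable N -> separable (fun k j => M k j * N k j).
Proof.
move=> [r rM] [t tN].
exists [seq (a.1 * b.1, a.2 * b.2) | a <- r, b <- t] => k j.
rewrite big_allpairs_dep rM tN mulr_suml; apply: eq_bigr => a _.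
by rewrite mulr_sumr; apply: eq_bigr => b _; rewrite !rmorphM mulrACA.
Qed.

Lemma separable_sum (I : Type) (r : seq I) (E : I -> 'I_s.+1 -> 'I_s.+1 -> {poly K}) :
  (forall i, separable (E i)) -> separable (fun k j => \sum_(i <- r) E i k j).
Proof.
move=> sepE; elim: r => [|i r IH].
  by apply: eq_separable (separable_const 0) => k j; rewrite big_nil.
by apply: eq_separable (separableD (sepE i) IH) => k j; rewrite big_cons.
Qed.

Lemma separable_prod (I : Type) (r : seq I) (E : I -> 'I_s.+1 -> 'I_s.+1 -> {poly K}) :
  (forall i, separable (E i)) -> separable (fun k j => \prod_(i <- r) E i k j).
Proof.
move=> sepE; elim: r => [|i r IH].
  by apply: eq_separable (separable_const 1) => k j; rewrite big_nil.
by apply: eq_separable (separableM (sepE i) IH) => k j; rewrite big_cons.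
Qed.

Lemma separable_det N (E : 'I_N -> 'I_N -> 'I_s.+1 -> 'I_s.+1 -> {poly K}) :
  (forall a b, separable (E a b)) ->
  separable (fun k j => \det (\matrix_(a, b) E a b k j)).
Proof.
move=> sepE; apply: separable_sum => t; apply: separableM.
  by apply: eq_separable (separable_const ((-1) ^+ t)) => k j; rewrite rmorph_sign.
apply: separable_prod => i.
by apply: eq_separable (sepE i (t i)) => k j; rewrite mxE.
Qed.

Hypothesis x_affine : affine_points x.

(* X_0 takes the same value T at both points, so it does not occur in the
   difference quotients. *)
Definition has_difference_quotients F :=
  exists D : 'I_n -> 'I_s.+1 -> 'I_s.+1 -> {poly K},
  [/\ forall a, separable (D a),
      forall a k, D a k k = point_restr x k (mderiv (lift ord0 a) F)
    & forall k j, point_restr x k F - point_restr x j F =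
        \sum_a (point_restr x k 'X_(lift ord0 a) -
                point_restr x j 'X_(lift ord0 a)) * D a k j].

Lemma difference_quotientsC c : has_difference_quotients c%:MP.
Proof.
exists (fun _ _ _ => 0); split=> [a|a k|k j].
- exact: (separable_const 0).
- by rewrite mderivC rmorph0.
by rewrite !point_restrC subrr big1 // => a _; rewrite mulr0.
Qed.

Lemma difference_quotientsU i : has_difference_quotients 'X_i.
Proof.
exists (fun a _ _ => (i == lift ord0 a)%:R%:P); split=> [a|a k|k j].
- exact: separable_const.
- by rewrite mderivU !rmorph_nat.
case: (unliftP ord0 i) => [i0 ->|->].
  rewrite (bigD1 i0) //= eqxx mulr1 big1 ?addr0 // => a ne.
  by rewrite (inj_eq lift_inj) eq_sym (negPf ne) mulr0.
rewrite !point_restrU !(normalized0 x_affine) subrr big1 // => a _.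
by rewrite mulr0.
Qed.

Lemma difference_quotientsD F G : has_difference_quotients F ->
  has_difference_quotients G -> has_difference_quotients (F + G).
Proof.
move=> [D [sD dD eD]] [E [sE dE eE]].
exists (fun a k j => D a k j + E a k j); split=> [a|a k|k j].
- exact: separableD.
- by rewrite mderivD rmorphD dD dE.
rewrite !rmorphD opprD addrACA /= eD eE -big_split; apply: eq_bigr => a _.
by rewrite mulrDr.
Qed.

(** Leibniz rule for differences: FG(p) - FG(q) = (F(p) - F(q)) G(p) + F(q) (G(p) - G(q)). *)
Lemma difference_quotientsM F G : has_difference_quotients F ->
  has_difference_quotients G -> has_difference_quotients (F * G).
Proof.
move=> [D [sD dD eD]] [E [sE dE eE]].
exists (fun a k j => D a k j * point_restr x k G + point_restr x j F * E a k j).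
split=> [a|a k|k j].
- apply: separableD; apply: separableM => //; first exact: separable_left.
  exact: separable_right.
- by rewrite mderivM rmorphD !rmorphM dD dE.
rewrite !rmorphM /= -[LHS](subrKA (point_restr x j F * point_restr x k G)).
rewrite -mulrBl -mulrBr eD eE mulr_suml mulr_sumr -big_split.
by apply: eq_bigr => a _; rewrite mulrDr mulrA (mulrCA (point_restr x j F)).
Qed.

Lemma difference_quotients F : has_difference_quotients F.
Proof.
have hdq1 : has_difference_quotients 1.
  by rewrite -mpolyC1; apply: difference_quotientsC.
elim/mpolyind: F => [|c mu F _ _ IH].
  by rewrite -mpolyC0; apply: difference_quotientsC.
apply: difference_quotientsD => //; rewrite -mul_mpolyC.
apply: difference_quotientsM; first exact: difference_quotientsC.
rewrite mpolyXE_id; apply: (big_ind has_difference_quotients) => [//||i _].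
  exact: difference_quotientsM.
elim: (mu i) => [//|e IHe]; rewrite exprS.
by apply: difference_quotientsM => //; apply: difference_quotientsU.
Qed.

(* The determinant of the difference quotients of n elements of the ideal
   annihilates the kernel of R (x) R -> R by Cramer's rule, hence it vanishes
   off the diagonal. *)
Lemma separable_jacobian (G : 'I_n -> P) :
  (forall b, G b \in vanishing_ideal x) ->
  separable (fun k j => if k == j then
    point_restr x k (\det (\matrix_(a, b) mderiv (lift ord0 a) (G b))) else 0).
Proof.
move=> IG; have Gpt b k : point_restr x k (G b) = 0.
  by move: (IG b) k => /(vanishing_point_restr x_affine).
have [D DP] := fin_all_exists (fun b => difference_quotients (G b)).
have sD a b : separable (D b a) by case: (DP b).
apply: eq_separable (separable_det sD) => k j.
case: eqVneq => [<-|ne].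
  rewrite -det_map_mx; congr (\det _); apply/matrixP => a b; rewrite !mxE.
  by case: (DP b).
apply/eqP/det0P.
(* The coordinate difference of the two points is a left kernel vector: its product with column [b]
   is the difference of the values of [G b], both 0. It is nonzero because distinct points already
   differ off the coordinate [ord0]. *)
exists (\row_a (point_restr x k 'X_(lift ord0 a) - point_restr x j 'X_(lift ord0 a))).
  apply: contra_neq ne => /rowP v0; apply: (normalized_inj x_affine).
  apply/rowP => i; case: (unliftP ord0 i) => [i0 ->|->]; last first.
    by rewrite !(normalized0 x_affine).
  move: (v0 i0); rewrite !mxE !point_restrU -scalerBl => /eqP.
  by rewrite scaler_eq0 polyX_eq0 orbF subr_eq0 !mxE => /eqP.
apply/rowP => b; rewrite !mxE; case: (DP b) => _ _ /(_ k j).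
rewrite !Gpt subrr => e; rewrite [RHS]e.
by apply: eq_bigr => a _; rewrite !mxE.
Qed.

(** Compute [Phi (embed f)] twice, as an extension of [phi] and through the trace. *)
Lemma complementary_sigma g (f : R) : complementary_module x g ->
  exists q, sigma (g * embed f) = tofrac q.
Proof.
move=> [_ [phi [Phi [_ [_ _ Phi_embed] PhiE]]]]; exists (phi f).
rewrite -Phi_embed PhiE // => j; rewrite embedE ffunE.
by exists 0, (point_restr x j (repr f)); rewrite expr0 tofrac1 divr1.
Qed.

Lemma embed_sum (I : Type) (r : seq I) (E : I -> P) :
  embed (residue x (\sum_(i <- r) E i)) = \sum_(i <- r) embed (residue x (E i)).
Proof.
apply/ffunP => j; rewrite sum_ffunE embed_residue // ffunE.
rewrite (rmorph_sum (point_restr x j)) rmorph_sum.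
by apply: eq_bigr => i _; rewrite embed_residue // ffunE.
Qed.

Lemma jacobian_complementary (G : 'I_n -> P) g :
  (forall b, G b \in vanishing_ideal x) -> complementary_module x g ->
  exists H : P, embed (residue x (\det (\matrix_(a, b) mderiv (lift ord0 a) (G b)))) * g
    = embed (residue x H).
Proof.
move=> /separable_jacobian [r rJ] /complementary_sigma Cg.
set J := \det _ in rJ *.
have [q qE] := fin_all_exists (fun t : 'I_(size r) =>
  Cg (residue x (tnth (in_tuple r) t).2)).
(* The sum of the A_t q_t(X_0), where q_t = sigma(g B_t) is a polynomial. *)
exists (\sum_t (tnth (in_tuple r) t).1 * (map_poly (@mpolyC n.+1 K) (q t)).['X_ord0]).
rewrite embed_residue // embed_sum; apply/ffunP => k; rewrite sum_ffunE !ffunE.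
(* Padding with the zero off-diagonal terms makes room for the separable expression; summing over
   [j] first then produces the traces. *)
have -> : tofrac (point_restr x k J) * g k =
    \sum_j tofrac (if k == j then point_restr x k J else 0) * g j.
  rewrite (bigD1 k) //= eqxx big1 ?addr0 // => j ne.
  by rewrite eq_sym (negPf ne) tofrac0 mul0r.
transitivity (\sum_(t < size r) tofrac (point_restr x k (tnth (in_tuple r) t).1) *
   sigma (g * embed (residue x (tnth (in_tuple r) t).2))).
  under [RHS]eq_bigr do rewrite mulr_sumr.
  rewrite exchange_big; apply: eq_bigr => j _ /=.
  rewrite rJ rmorph_sum mulr_suml (big_tnth _ _ r); apply: eq_bigr => t _ /=.
  by rewrite embed_residue // !ffunE rmorphM -mulrA (mulrC (g j)).
(* As X_0 restricts to T at every point, q_t(X_0) restricts to q_t. *)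
apply: eq_bigr => t _; rewrite qE embed_residue // ffunE -rmorphM.
rewrite (rmorphM (point_restr x k)); congr (tofrac (_ * _)).
rewrite -horner_map -map_poly_comp /=.
rewrite (eq_map_poly (g := polyC)) => [|c]; last exact: point_restrC.
rewrite point_restrU normalized0 // scale1r; exact: (esym (comp_polyXr _)).
Qed.

(** Each generating minor is a Jacobian of ideal elements, so it maps the complementary module into
    [R]; [R]-linear combinations inherit this. *)
Lemma kaehler_sub_dedekind (m : nat) (F : 'I_m -> P) (a : R) :
  homog_generators x F -> kaehler_different F a -> dedekind_different x (embed a).
Proof.
move=> [_ FI] [N [c [M [minM ->]]]]; split=> [j|g Cg].
  rewrite embedE ffunE.
  exists 0, (point_restr x j (repr (\sum_(k < N) c k * M k))).
  by rewrite expr0 tofrac1 divr1.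
have IF b : F b \in vanishing_ideal x.
  by apply/FI; apply: ideal_gen_incl; exists b.
have /fin_all_exists [H HE] (k : 'I_N) : exists H, embed (M k) * g = embed (residue x H).
  have [e [_ ->]] := minM k.
  by apply: jacobian_complementary Cg => b; apply: IF.
exists (residue x (\sum_k repr (c k) * H k)).
have -> : \sum_(k < N) c k * M k = residue x (\sum_k repr (c k) * repr (M k)).
  rewrite rmorph_sum; apply: eq_bigr => k _; rewrite rmorphM /=.
  by congr (_ * _); rewrite /residue reprK.
rewrite !embed_sum mulr_suml; apply: eq_bigr => k _; apply/ffunP => j.
have := congr1 (fun h : {ffun _ -> _} => h j) (HE k).
rewrite embedE !embed_residue // !ffunE => HEj.
by rewrite !rmorphM -mulrA HEj.
Qed.

End KaehlerInDedekind.

(** * Jacobians of arbitrary ideal elements in terms of the generators *)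

Section JacobianOfIdealElements.
Variables (K : fieldType) (n s : nat) (x : 'I_s.+1 -> 'rV[K]_n.+1).
Variables (m : nat) (F : 'I_m -> {mpoly K[n.+1]}).
Local Notation P := {mpoly K[n.+1]}.
Local Notation R := (coord_ring x).

(** Coefficients of summands with the same generator are collected. *)
Lemma ideal_gen_family (G : P) : ideal_gen (fun H => exists j, H = F j) G ->
  exists c : 'I_m -> P, G = \sum_k c k * F k.
Proof.
move=> [N [a [g [gF ->]]]]; have [j jE] := fin_all_exists gF.
exists (fun k => \sum_(l | j l == k) a l).
under [RHS]eq_bigr do rewrite mulr_suml.
rewrite (exchange_big_dep xpredT) //=; apply: eq_bigr => l _.
by under eq_bigl do rewrite eq_sym; rewrite big_pred1_eq jE.
Qed.

(* The sign and the zero of the alternating property reduce arbitrary choices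
   of columns to the strictly increasing ones. *)
Lemma kaehler_any_columns (f : 'I_n -> 'I_m) :
  kaehler_different F (\det (\matrix_(a, b) residue x (mderiv (lift ord0 a) (F (f b))))).
Proof.
have [/injectiveP f_inj|/injectivePn [b1 [b2 ne fb]]] := boolP (injectiveb f); last first.
  rewrite -det_tr (determinant_alternate ne); first exact: ideal_gen0.
  by move=> a; rewrite !mxE fb.
have [c [t [c_incr fc]]] := sort_injective_ord f_inj.
have -> : \matrix_(a, b) residue x (mderiv (lift ord0 a) (F (f b))) =
  col_perm t (map_mx (residue x) (\matrix_(a, b) mderiv (lift ord0 a) (F (c b)))).
  by apply/matrixP => a b; rewrite !mxE fc.
rewrite col_permE det_mulmx det_map_mx mulrC; apply: ideal_genM.
by apply: ideal_gen_incl; exists c.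
Qed.

(** Modulo the ideal, derivatives of the coefficients drop out of the product rule, so the Jacobian
    matrix of [G] is that of [F] times a matrix over [R]. *)
Lemma jacobian_kaehler (G : 'I_n -> P) : homog_generators x F ->
  (forall b, G b \in vanishing_ideal x) ->
  kaehler_different F (residue x (\det (\matrix_(a, b) mderiv (lift ord0 a) (G b)))).
Proof.
move=> [_ FI] IG.
have [C GE] := fin_all_exists (fun b => ideal_gen_family (proj1 (FI (G b)) (IG b))).
have F0 k : residue x (F k) = 0.
  rewrite -[RHS](rmorph0 (residue x)); apply/residueP; rewrite subr0.
  by apply/FI; apply: ideal_gen_incl; exists k.
rewrite -det_map_mx.
have -> : map_mx (residue x) (\matrix_(a, b) mderiv (lift ord0 a) (G b)) =
   \matrix_(a, b) \sum_k residue x (mderiv (lift ord0 a) (F k)) * residue x (C b k).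
  apply/matrixP => a b; rewrite !mxE GE (raddf_sum (mderiv _)).
  rewrite (rmorph_sum (residue x)); apply: eq_bigr => k _ /=.
  rewrite mderivM (rmorphD (residue x)) !(rmorphM (residue x)) /= F0 mulr0 add0r.
  exact: mulrC.
rewrite det_col_comb; apply: ideal_gen_sum => f _; apply: ideal_genM.
exact: kaehler_any_columns.
Qed.

End JacobianOfIdealElements.

(** * Separators of the points *)

Section TruncationInKaehler.
Variables (K : fieldType) (n s : nat) (x : 'I_s.+1 -> 'rV[K]_n.+1).
Local Notation P := {mpoly K[n.+1]}.
Hypothesis x_affine : affine_points x.

Definition separator j (f : P) d :=
  forall k, point_restr x k f = (k == j)%:R *: 'X^d.

(** Evaluating a basis of R_r at the points gives a square matrix, invertible because an element of
    [R] is determined by its values. Row [j] of the inverse holds the coefficients of the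
    separator. *)
Lemma separator_exists r j : hilbert_function x r s.+1 -> exists f, separator j f r.
Proof.
move=> [e [e_homog e_free _]].
have [E E_homog eE] := fin_all_exists2 e_homog.
pose M := \matrix_(i, k) (E i).@[fun l => normalized x k 0 l].
have evE (c : 'rV_s.+1) k :
    point_restr x k (\sum_i (c 0 i)%:MP * E i) = (c *m M) 0 k *: 'X^r.
  rewrite (rmorph_sum (point_restr x k)) mxE scaler_suml; apply: eq_bigr => i _ /=.
  rewrite (rmorphM (point_restr x k)) /= point_restrC mul_polyC.
  by rewrite [point_restr _ _ _](line_restr_homog _ (E_homog i)) scalerA mxE.
have : row_free M.
  apply: inj_row_free => c cM0; apply/rowP => i; rewrite mxE.
  apply: (e_free (fun i => c 0 i)).
  have -> : \sum_k residue x (c 0 k)%:MP * e k =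
      residue x (\sum_k (c 0 k)%:MP * E k).
    rewrite (rmorph_sum (residue x)); apply: eq_bigr => k _.
    by rewrite (rmorphM (residue x)) /= eE.
  rewrite -[RHS](rmorph0 (residue x)); apply: residue_eq => // k.
  by rewrite evE cM0 mxE scale0r rmorph0.
rewrite row_free_unit => M_unit.
pose c : 'rV[K]_s.+1 := delta_mx 0 j *m invmx M.
exists (\sum_i (c 0 i)%:MP * E i) => k.
by rewrite evE mulmxKV // mxE eqxx.
Qed.

End TruncationInKaehler.

(** * Components of high degree lie in the Kaehler different *)

Section SeparatorJacobian.
Variables (K : fieldType) (n s : nat) (x : 'I_s.+1 -> 'rV[K]_n.+3).
Local Notation P := {mpoly K[n.+3]}.
Hypothesis x_affine : affine_points x.

(* The elements (X_(b+1) - p_j(b+1) X_0) f of the ideal have at p_j the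
   Jacobian matrix f(p_j) 1, and at any other point, where f vanishes, a
   Jacobian matrix of rank at most 1. *)
Lemma separator_jacobian j (f : P) d : separator x j f d ->
  exists2 G : 'I_n.+2 -> P, forall b, G b \in vanishing_ideal x &
  separator x j (\det (\matrix_(a, b) mderiv (lift ord0 a) (G b))) (n.+2 * d).
Proof.
move=> fP.
pose L (b : 'I_n.+2) : P :=
  'X_(lift ord0 b) - (normalized x j 0 (lift ord0 b))%:MP * 'X_ord0.
have LE k b : point_restr x k (L b) =
    (normalized x k 0 (lift ord0 b) - normalized x j 0 (lift ord0 b)) *: 'X.
  rewrite (rmorphB (point_restr x k)) (rmorphM (point_restr x k)) /=.
  by rewrite !point_restrU point_restrC normalized0 // scale1r mul_polyC scalerBl.
have dL a b : mderiv (lift ord0 a) (L b) = (b == a)%:R.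
  by rewrite mderivB mderiv_mulC !mderivU (inj_eq lift_inj) mulr0 subr0.
exists (fun b => L b * f) => [b|k].
  apply/(vanishing_point_restr x_affine) => k.
  rewrite (rmorphM (point_restr x k)) /= fP LE.
  by case: eqVneq => [->|_]; rewrite ?subrr !scale0r ?mul0r ?mulr0.
rewrite -det_map_mx.
have -> : map_mx (point_restr x k) (\matrix_(a, b) mderiv (lift ord0 a) (L b * f))
  = \matrix_(a, b) ((b == a)%:R * point_restr x k f +
       point_restr x k (mderiv (lift ord0 a) f) * point_restr x k (L b)).
  apply/matrixP => a b; rewrite !mxE mderivM (rmorphD (point_restr x k)).
  rewrite !(rmorphM (point_restr x k)) /= dL rmorph_nat; congr (_ + _).
  exact: mulrC.
rewrite fP; have [->|ne] := eqVneq k j; last first.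
  rewrite !scale0r -[RHS](@det_outer_product _ n
    (fun a => point_restr x k (mderiv (lift ord0 a) f))
    (fun b => point_restr x k (L b))).
  by congr (\det _); apply/matrixP => a b; rewrite !mxE mulr0 add0r.
rewrite !scale1r mulnC exprM -[RHS]det_scalar; congr (\det _); apply/matrixP => a b.
by rewrite !mxE LE subrr scale0r mulr0 addr0 eq_sym mulr_natl.
Qed.

(** Interpolation: a form is recovered in [R] from its values at the points, using the Jacobians
    [J j] as separators and a power of X_0 to adjust the degree. *)
Lemma truncation_sub_kaehler (m : nat) (F : 'I_m -> P) r (a : coord_ring x) :
  homog_generators x F -> hilbert_function x r s.+1 ->
  truncation (n.+2 * r) a -> kaehler_different F a.
Proof.
move=> Fgen hilb [N [d [c [cP ->]]]]; apply: ideal_gen_sum => l _.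
have [led [H H_homog ->]] := cP l.
have [f fP] := fin_all_exists (fun j => separator_exists x_affine j hilb).
have [G GI GP] := fin_all_exists2 (fun j => separator_jacobian (fP j)).
pose J j := \det (\matrix_(a, b) mderiv (lift ord0 a) (G j b)).
have -> : residue x H = \sum_j residue x ((H.@[fun i => normalized x j 0 i])%:MP *
    'X_ord0 ^+ (d l - n.+2 * r)) * residue x (J j).
  rewrite -(eq_bigr _ (fun j _ => rmorphM (residue x) _ _)) -(rmorph_sum (residue x)).
  apply: residue_eq => // k; rewrite (rmorph_sum (point_restr x k)) /=.
  rewrite (bigD1 k) //= big1 => [|j ne].
    rewrite addr0 !(rmorphM (point_restr x k)) (rmorphXn (point_restr x k)) /=.
    rewrite point_restrC point_restrU normalized0 // scale1r GP eqxx scale1r.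
    rewrite -mulrA -exprD subnK // mul_polyC.
    exact: line_restr_homog.
  by rewrite (rmorphM (point_restr x k)) /= GP eq_sym (negPf ne) scale0r mulr0.
by apply: ideal_gen_sum => j _; apply: ideal_genM; apply: jacobian_kaehler.
Qed.

End SeparatorJacobian.

Theorem corollary3p8 (K : fieldType) (s : nat) (x : 'I_s.+1 -> 'rV[K]_3)
    (hx : affine_points x)
    (m : nat) (F : 'I_m -> {mpoly K[3]}) (hF : homog_generators x F)
    (hmin : minimal_dedekind_different x) :
  forall f : {ffun 'I_s.+1 -> {fraction {poly K}}},
    dedekind_different x f <->
    exists2 a : coord_ring x, kaehler_different F a & f = embed a.
Proof.
have [r [[hilb _] delta_min]] := hmin.
move=> f; split=> [/delta_min [a ra ->]|[a Fa ->]].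
  (* In the plane, [n.+2 * r] is exactly the bound [2 * r] of a minimal Dedekind different. *)
  by exists a => //; apply: truncation_sub_kaehler hF (hilb r (leqnn r)) ra.
exact: kaehler_sub_dedekind Fa.
Qed.
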